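(* Let $C>0$. If there exists a rectifiable escape path (for the triangle $T$ of the context) of length $<C$, then there are an integer $N$ and a standard polygonal escape path $\eta$ (for $T$) of length $<C$ that is length-minimal among polygonal escape paths (for $T$) with at most $N$ segments.
   Context: Here $T=\operatorname{conv}\{(-c,0),(c,0),(0,s)\}\subset\mathbb R^2$ with $s=\frac{766}{\sqrt{625565}}$ and $c=\frac{197}{\sqrt{625565}}$. A rectifiable path is a continuous curve of finite length in $\mathbb R^2$. A path is an escape path for $T$ if no translated and rotated copy of it is contained in the interior of $T$. A polygonal path is given by its temporal sequence of vertices $P_0,\dots,P_m$, joined consecutively by segments. A polygonal path is standard if it is simple (non-self-intersecting) and its nonrepeated vertices are exactly the extreme vertices of its convex hull, each visited once. *)

(* Defs.v *)
From mathcomp Require Export all_boot all_order all_algebra.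
From mathcomp Require Export all_classical all_reals all_analysis.
Export numFieldNormedType.Exports.

Set Implicit Arguments.
Unset Strict Implicit.
Unset Printing Implicit Defensive.

Import Order.TTheory GRing.Theory Num.Theory.

Local Open Scope classical_set_scope.
Local Open Scope ring_scope.

(* The norm and distance that the library puts on R * R are the sup ones; they
   give the usual topology, but lengths need the Euclidean distance below. *)
Notation plane R := (R * R)%type.

Definition edist (R : realType) (p q : plane R) : R :=
  Num.sqrt ((p.1 - q.1) ^+ 2 + (p.2 - q.2) ^+ 2).

Definition hull (R : realType) (A : set (plane R)) : set (plane R) :=
  smallest (@convex_set R (plane R)) A.

Definition extreme_points (R : realType) (K : set (plane R)) :
    set (plane R) :=
  [set x | K x /\ forall (y z : plane R) (t : R), K y -> K z ->
     0 < t < 1 -> x = (1 - t) *: y + t *: z -> y = z].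

Definition segment (R : realType) (p q : plane R) : set (plane R) :=
  [set (1 - t) *: p + t *: q | t in `[0, 1]].

(* 625565 is written 625 * 1000 + 565 because numerals in a ring are unary. *)
Definition triangle_s (R : realType) : R := 766 / Num.sqrt (625 * 1000 + 565).
Definition triangle_c (R : realType) : R := 197 / Num.sqrt (625 * 1000 + 565).

Definition triangle (R : realType) : set (plane R) :=
  hull [set p | [\/ p = (- triangle_c R, 0), p = (triangle_c R, 0)
                 | p = (0, triangle_s R)]].
Arguments triangle R : clear implicits.

Definition rigid_motion (R : realType) (theta : R) (v p : plane R) : plane R :=
  (cos theta * p.1 - sin theta * p.2, sin theta * p.1 + cos theta * p.2) + v.

(* Whether a path is an escape path depends only on its trace X. *)
Definition escapes (R : realType) (X : set (plane R)) : Prop :=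
  forall (theta : R) (v : plane R),
    ~ (rigid_motion theta v @` X `<=` interior (triangle R)).

(* A polygonal path is the sequence P_0, .., P_m of its vertices. *)
Definition poly_length (R : realType) (P : seq (plane R)) : R :=
  \sum_(i < (size P).-1) edist P`_i P`_i.+1.

(* The vertices are added so that a one-vertex path has trace {P_0}. *)
Definition poly_trace (R : realType) (P : seq (plane R)) : set (plane R) :=
  [set` P] `|` \bigcup_(i in `I_(size P).-1) segment P`_i P`_i.+1.

(* Only consecutive segments may meet, and only at their common vertex. *)
Definition poly_simple (R : realType) (P : seq (plane R)) : Prop :=
  forall i j : nat, (i < j < (size P).-1)%N ->
    segment P`_i P`_i.+1 `&` segment P`_j P`_j.+1 =
      if j == i.+1 then [set P`_j] else set0.

(* With poly_simple, uniq makes the path injective: no segment is degenerate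
   and P_0 <> P_m when 0 < m. *)
Definition standard (R : realType) (P : seq (plane R)) : Prop :=
  [/\ poly_simple P, uniq P
    & [set` P] = extreme_points (hull (poly_trace P))].

(* The supremum of the lengths of the inscribed polygonal paths. *)
Definition curve_length (R : realType) (gamma : R -> plane R) : \bar R :=
  ereal_sup [set (poly_length [seq gamma t | t <- 0 :: s])%:E
            | s in itv_partition 0 1].

Definition rectifiable_path (R : realType) (gamma : R -> plane R) : Prop :=
  {within `[0, 1], continuous gamma} /\ (curve_length gamma < +oo)%E.

(* Main.v *)
From mathcomp Require Import finmap.
Require Import Defs.
From mathcomp Require Import zify ring lra.

Import Order.TTheory GRing.Theory Num.Theory.

Local Open Scope classical_set_scope.
Local Open Scope ring_scope.

(** The interior [K] of the triangle enters only as an open convex subset of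
    the plane. Rigid motions are affine, so whether a polygonal path can be
    moved into [K] depends only on the hull of its vertices ([avoids_hull]).

    A rectifiable escape path can be replaced by a polygonal one. If its length
    is less than [C], it can be scaled by some [a > 1] and still be shorter
    than [C]. A polygon inscribed finely enough in the scaled curve is an
    escape path: a position of it inside [K] would keep the scaled curve within
    a small distance of [K], and shrinking back by [1 / a] towards the centre
    of a ball in [K] would bring the curve inside [K] ([avoids_approx]).

    Let [N] be the number of segments of that polygon. Fixing the first vertex
    at the origin, the escape paths with at most [N] segments and bounded
    length form a compact set, because [K] is open; so there is a shortest one
    ([exists_shortest]), and among the shortest ones one with the fewest
    vertices ([exists_tight]).

    That path is standard. A vertex in the hull of the others could be dropped,
    leaving an escape path that is no longer and has fewer vertices; hence the
    vertices are distinct and extreme ([tight_notin_hull]). If two segments met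
    elsewhere than at a shared vertex, either three vertices would be
    collinear, or reversing the part of the path between the two segments would
    give a strictly shorter path on the same vertices ([edist_uncross],
    [poly_length_reverse]). *)

(** * Segments, hulls and extreme points *)

Lemma plane_eq {R : realType} (p q : plane R) :
  p.1 = q.1 -> p.2 = q.2 -> p = q.
Proof. by case: p q => [? ?] [? ?] /= -> ->. Qed.

Lemma planeDE {R : realType} (p q : plane R) :
  ((p + q).1 = p.1 + q.1) * ((p + q).2 = p.2 + q.2).
Proof. by []. Qed.

Lemma planeZE {R : realType} (a : R) (p : plane R) :
  ((a *: p).1 = a * p.1) * ((a *: p).2 = a * p.2).
Proof. by []. Qed.

Lemma planeNE {R : realType} (p : plane R) :
  ((- p).1 = - p.1) * ((- p).2 = - p.2).
Proof. by []. Qed.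

Definition planeE {R : realType} := (@planeDE R, @planeNE R, @planeZE R).

Lemma convex_setP {R : realType} (A : set (plane R)) :
  @convex_set R (plane R) A <->
  forall x y (t : R), A x -> A y -> 0 <= t <= 1 -> A ((1 - t) *: x + t *: y).
Proof.
split=> [cA x y t Ax Ay /andP[t0 t1]|cA x y t].
  pose u : {i01 R} := Itv01 t0 t1.
  have := cA y x u; rewrite !inE => /(_ Ay Ax).
  by rewrite /conv/= addrC.
rewrite !inE => Ax Ay; rewrite /conv /= addrC; apply: cA => //.
by apply/andP; split.
Qed.

Lemma convex_hull {R : realType} (A : set (plane R)) :
  @convex_set R (plane R) (hull A).
Proof.
apply/convex_setP => x y t Ax Ay t01 B [cB AB].
by move/convex_setP: (cB); apply=> //; [apply: Ax|apply: Ay].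
Qed.

Lemma convex_interior {R : realType} (A : set (plane R)) :
  @convex_set R (plane R) A -> @convex_set R (plane R) (interior A).
Proof.
move=> /convex_setP cA; apply/convex_setP => x y t.
move=> /nbhs_ballP[r /= r0 rA] /nbhs_ballP[s /= s0 sA] t01.
apply/nbhs_ballP; exists (Num.min r s); first by rewrite /= lt_min r0.
move=> q; rewrite -ball_normE /= lt_min => /andP[qr qs].
set z := _ - _ in qr qs.
have -> : q = (1 - t) *: (x - z) + t *: (y - z).
  by apply: plane_eq; rewrite /z !planeE; ring.
by apply: cA => //; [apply: rA|apply: sA]; rewrite -ball_normE /= subKr.
Qed.

Lemma sub_hull {R : realType} (A : set (plane R)) : A `<=` hull A.
Proof. exact: sub_smallest. Qed.

Lemma hull_min {R : realType} (A B : set (plane R)) :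
  @convex_set R (plane R) B -> A `<=` B -> hull A `<=` B.
Proof. by move=> cB AB x; apply. Qed.

Lemma hullS {R : realType} (A B : set (plane R)) :
  A `<=` B -> hull A `<=` hull B.
Proof.
move=> AB; apply: hull_min; first exact: convex_hull.
by apply: subset_trans AB _; exact: sub_hull.
Qed.

Lemma segmentP {R : realType} (p q x : plane R) :
  segment p q x <-> exists2 t : R, 0 <= t <= 1 & x = (1 - t) *: p + t *: q.
Proof.
split; last by case=> t t01 ->; exists t; rewrite //= in_itv.
by case=> t; rewrite /= in_itv /= => t01 <-; exists t.
Qed.

Lemma segment_sub {R : realType} (A : set (plane R)) (p q : plane R) :
  @convex_set R (plane R) A -> A p -> A q -> segment p q `<=` A.
Proof.
by move=> /convex_setP cA Ap Aq x /segmentP[t t01 ->]; exact: cA.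
Qed.

Lemma segmentC {R : realType} (p q : plane R) : segment p q = segment q p.
Proof.
suff H (a b : plane R) : segment a b `<=` segment b a by apply/seteqP; split.
move=> x /segmentP[t t01 ->]; apply/segmentP; exists (1 - t); first by lra.
by rewrite addrC; congr (_ *: _ + _); lra.
Qed.

Lemma segmentL {R : realType} (p q : plane R) : segment p q p.
Proof.
apply/segmentP; exists 0; first by rewrite lexx ler01.
by rewrite subr0 scale1r scale0r addr0.
Qed.

Lemma segmentR {R : realType} (p q : plane R) : segment p q q.
Proof. by rewrite segmentC; exact: segmentL. Qed.

(** Two segments from [a] through a common point other than [a] point in the
    same direction, so the shorter one lies inside the longer one. *)
Lemma segments_through {R : realType} (a b c x : plane R) : x <> a ->
  segment a b x -> segment a c x -> segment a c b \/ segment a b c.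
Proof.
move=> xa /segmentP[t t01 xt] /segmentP[u u01 xu].
have xn0 (s : R) (d : plane R) : x = (1 - s) *: a + s *: d -> s <> 0.
  by move=> + s0; rewrite s0 subr0 scale1r scale0r addr0 => /xa.
have {xn0}[/eqP t0 /eqP u0] := (xn0 _ _ xt, xn0 _ _ xu).
have e := etrans (esym xt) xu.
have e1 := congr1 fst e; have e2 := congr1 snd e.
rewrite !planeE in e1 e2.
case: (leP u t) => ut; [left|right]; apply/segmentP.
  exists (u / t).
    by rewrite ler_pdivrMr ?ler_pdivlMr; lra.
  apply: plane_eq; rewrite !planeE; apply: (mulfI t0).
  - by transitivity (t * a.1 - u * a.1 + u * c.1); [lra|field].
  - by transitivity (t * a.2 - u * a.2 + u * c.2); [lra|field].
exists (t / u).
  by rewrite ler_pdivrMr ?ler_pdivlMr; lra.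
apply: plane_eq; rewrite !planeE; apply: (mulfI u0).
- by transitivity (u * a.1 - t * a.1 + t * b.1); [lra|field].
- by transitivity (u * a.2 - t * a.2 + t * b.2); [lra|field].
Qed.

(** Deleting an extreme point of a convex set leaves a convex set; if the point
    were not in [A], that smaller convex set would already contain [A]. *)
Lemma extreme_points_hull_sub {R : realType} (A : set (plane R)) :
  extreme_points (hull A) `<=` A.
Proof.
move=> x [Hx ext]; apply: contrapT => nAx.
suff /(_ x Hx) [_ /(_ erefl)] : hull A `<=` [set y | hull A y /\ y <> x] by [].
apply: hull_min => [|y Ay]; last first.
  by split; [exact: sub_hull|move=> yx; apply: nAx; rewrite -yx].
apply/convex_setP => y z t [Hy yx] [Hz zx] t01; split.
  by move/convex_setP: (@convex_hull R A); apply.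
move=> /esym e.
have [t0|t0] := eqVneq t 0.
  by apply: yx; rewrite e t0 subr0 scale1r scale0r addr0.
have [t1|t1] := eqVneq t 1.
  by apply: zx; rewrite e t1 subrr scale1r scale0r add0r.
have yz : y = z by apply: (ext y z t) => //; rewrite !lt_neqAle eq_sym t0 t1.
by apply: yx; rewrite e -yz -scalerDl subrK scale1r.
Qed.

Lemma scaler_mix {R : realType} (a b c : R) (w v : plane R) : c = a + b ->
  c != 0 -> c *: ((1 - b / c) *: w + (b / c) *: v) = a *: w + b *: v.
Proof.
by move=> cE c0; apply: plane_eq; rewrite !planeE; field: cE.
Qed.

(** The right-hand side describes a convex set: in a mixture of two of its
    points, the parts in the hull of [W] combine, after division by their total
    weight [c], into one point of that hull. *)
Lemma hull_setU1 {R : realType} (p : plane R) (W : set (plane R)) x :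
  hull (p |` W) x ->
  x = p \/ exists w, exists2 a : R,
    hull W w /\ 0 <= a <= 1 & x = (1 - a) *: p + a *: w.
Proof.
pose S := [set x | x = p \/ exists w, exists2 a : R,
  hull W w /\ 0 <= a <= 1 & x = (1 - a) *: p + a *: w].
move: x; suff HS : hull (p |` W) `<=` S by exact: HS.
apply: hull_min; last first.
  move=> x [->|Wx]; [by left|right; exists x, 1].
    by split; [exact: sub_hull|rewrite ler01 lexx].
  by rewrite subrr scale0r scale1r add0r.
have S_p w (a : R) : hull W w -> 0 <= a <= 1 -> S ((1 - a) *: p + a *: w).
  by move=> Ww a01; right; exists w, a.
have cW := (convex_setP (hull W)).1 (convex_hull W).
apply/convex_setP => x y t [->|[w [a [Ww a01] ->]]] [->|[v [b [Wv b01] ->]]] t01.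
- by left; rewrite -scalerDl subrK scale1r.
- rewrite (_ : _ + _ = (1 - t * b) *: p + (t * b) *: v).
    by apply: S_p => //; nra.
  by apply: plane_eq; rewrite !planeE; ring.
- rewrite (_ : _ + _ = (1 - (1 - t) * a) *: p + ((1 - t) * a) *: w).
    by apply: S_p => //; nra.
  by apply: plane_eq; rewrite !planeE; ring.
set c := (1 - t) * a + t * b.
have [c0|c0] := eqVneq c 0.
  have ta0 : (1 - t) * a = 0 by rewrite /c in c0; nra.
  have tb0 : t * b = 0 by rewrite /c in c0; nra.
  left; rewrite !scalerDr !scalerA !mulrBr !mulr1 ta0 tb0 !scale0r !addr0 !subr0.
  by rewrite -scalerDl subrK scale1r.
have c01 : 0 <= c <= 1 by rewrite /c; nra.
rewrite (_ : _ + _ =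
  (1 - c) *: p + c *: ((1 - t * b / c) *: w + (t * b / c) *: v)).
  apply: S_p => //; apply: cW => //.
  have cp : 0 < c by rewrite lt_neqAle eq_sym c0; case/andP: c01.
  by rewrite ler_pdivrMr // ler_pdivlMr // mul0r mul1r /c; nra.
rewrite (scaler_mix _ _ _ _ _ (erefl : c = _ + _)) //.
by apply: plane_eq; rewrite !planeE /c; ring.
Qed.

(** A point [p] outside the hull of [W] cannot be an interior point of a
    segment whose ends are in the join of [p] with that hull: solving for [p]
    would write it as a convex combination of points of the hull of [W]. *)
Lemma extreme_hull_setU1 {R : realType} (p : plane R) (W : set (plane R)) :
  ~ hull W p -> extreme_points (hull (p |` W)) p.
Proof.
move=> nWp; split; first by apply: sub_hull; left.
have cW := (convex_setP (hull W)).1 (convex_hull W).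
have key w v (a b t : R) : hull W w -> hull W v ->
    0 <= a <= 1 -> 0 <= b <= 1 -> 0 < t < 1 ->
    p = (1 - t) *: ((1 - a) *: p + a *: w) + t *: ((1 - b) *: p + b *: v) ->
    a = 0 /\ b = 0.
  move=> Ww Wv a01 b01 t01 e.
  have [c0|c0] := eqVneq ((1 - t) * a + t * b) 0; first by split; nra.
  exfalso; apply: nWp; set c := _ + _ in c0.
  have cp : 0 < c by rewrite lt_neqAle eq_sym c0 /c; nra.
  suff -> : p = (1 - t * b / c) *: w + (t * b / c) *: v.
    apply: cW => //.
    by rewrite ler_pdivrMr // ler_pdivlMr // mul0r mul1r /c; nra.
  apply: (scalerI c0); rewrite (scaler_mix _ _ _ _ _ (erefl : c = _ + _)) //.
  have /(congr1 fst) e1 := e; have /(congr1 snd) e2 := e.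
  by apply: plane_eq; rewrite !planeE /c in e1 e2 *; lra.
have comb0 d : (1 - 0) *: p + 0 *: d = p by rewrite subr0 scale1r scale0r addr0.
move=> y z t /hull_setU1 Hy /hull_setU1 Hz t01.
case: Hy Hz => [->|[w [a [Ww a01] ->]]] [->|[v [b [Wv b01] ->]]] //.
- move=> e; have [] := key v v 0 b t Wv Wv _ b01 t01;
    rewrite ?comb0 ?lexx ?ler01 //.
  by move=> _ ->; rewrite comb0.
- move=> e; have [] := key w w a 0 t Ww Ww a01 _ t01;
    rewrite ?comb0 ?lexx ?ler01 //.
  by move=> -> _; rewrite comb0.
by move=> /key[]// -> ->; rewrite !comb0.
Qed.

(** * Euclidean distance *)

Definition enorm {R : realType} (u : plane R) : R :=
  Num.sqrt (u.1 ^+ 2 + u.2 ^+ 2).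

Lemma edistE {R : realType} (p q : plane R) : edist p q = enorm (p - q).
Proof. by []. Qed.

Lemma enorm_ge0 {R : realType} (u : plane R) : 0 <= enorm u.
Proof. exact: sqrtr_ge0. Qed.

Lemma enorm_sqr {R : realType} (u : plane R) :
  enorm u ^+ 2 = u.1 ^+ 2 + u.2 ^+ 2.
Proof. by rewrite sqr_sqrtr // addr_ge0 // sqr_ge0. Qed.

Lemma dot_le_enorm {R : realType} (u v : plane R) :
  u.1 * v.1 + u.2 * v.2 <= enorm u * enorm v.
Proof.
rewrite leNgt; apply/negP => lt.
have uv0 : 0 <= enorm u * enorm v by rewrite mulr_ge0 ?enorm_ge0.
have : (enorm u * enorm v) ^+ 2 < (u.1 * v.1 + u.2 * v.2) ^+ 2.
  by rewrite ltr_sqr // nnegrE // (le_trans uv0) // ltW.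
rewrite exprMn !enorm_sqr ltNge => /negP; apply.
have := sqr_ge0 (u.1 * v.2 - u.2 * v.1); lra.
Qed.

Lemma ler_enormD {R : realType} (u v : plane R) :
  enorm (u + v) <= enorm u + enorm v.
Proof.
have uv0 : 0 <= enorm u + enorm v by rewrite addr_ge0 ?enorm_ge0.
rewrite -ler_sqr ?nnegrE ?enorm_ge0 // sqrrD !enorm_sqr !planeE.
have := dot_le_enorm u v; lra.
Qed.

(** Equality in the triangle inequality forces equality in Cauchy-Schwarz,
    hence parallel vectors. *)
Lemma enormD_eq {R : realType} (u v : plane R) :
  enorm u + enorm v <= enorm (u + v) -> enorm v *: u = enorm u *: v.
Proof.
have uv0 : 0 <= enorm u + enorm v by rewrite addr_ge0 ?enorm_ge0.
rewrite -ler_sqr ?nnegrE ?enorm_ge0 // sqrrD !enorm_sqr !planeE => H.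
have e : enorm u * enorm v = u.1 * v.1 + u.2 * v.2.
  by apply/eqP; rewrite eq_le dot_le_enorm andbT; lra.
have : (enorm v * u.1 - enorm u * v.1) ^+ 2 +
       (enorm v * u.2 - enorm u * v.2) ^+ 2 = 0.
  transitivity (enorm v ^+ 2 * (u.1 ^+ 2 + u.2 ^+ 2) +
                enorm u ^+ 2 * (v.1 ^+ 2 + v.2 ^+ 2) -
                2 * (enorm u * enorm v) * (u.1 * v.1 + u.2 * v.2)); first ring.
  by rewrite -!enorm_sqr -e; ring.
move/eqP; rewrite paddr_eq0 ?sqr_ge0 // !sqrf_eq0 !subr_eq0.
by case/andP => /eqP e1 /eqP e2; apply: plane_eq; rewrite !planeE.
Qed.

Lemma enorm_eq0 {R : realType} (u : plane R) : enorm u = 0 -> u = 0.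
Proof.
move=> u0; have := enorm_sqr u; rewrite u0 expr0n /= => /esym/eqP.
rewrite paddr_eq0 ?sqr_ge0 // !sqrf_eq0 => /andP[/eqP ? /eqP ?].
exact: plane_eq.
Qed.

Lemma edist_ge0 {R : realType} (p q : plane R) : 0 <= edist p q.
Proof. exact: sqrtr_ge0. Qed.

Lemma edistC {R : realType} (p q : plane R) : edist p q = edist q p.
Proof. by rewrite /edist; congr Num.sqrt; ring. Qed.

Lemma edistxx {R : realType} (p : plane R) : edist p p = 0.
Proof. by rewrite /edist !subrr expr0n addr0 sqrtr0. Qed.

Lemma edist_triangle {R : realType} (x p q : plane R) :
  edist p q <= edist p x + edist x q.
Proof.
rewrite !edistE (_ : p - q = (p - x) + (x - q)) ?ler_enormD //.
by rewrite addrA subrK.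
Qed.

Lemma edist_triangle_eq {R : realType} (x p q : plane R) :
  edist p x + edist x q <= edist p q -> segment p q x.
Proof.
rewrite !edistE (_ : p - q = (p - x) + (x - q)); last by rewrite addrA subrK.
move=> /enormD_eq; have := enorm_ge0 (p - x); have := enorm_ge0 (x - q).
set a := enorm (p - x); set b := enorm (x - q) => b0 a0 /= e.
have [ab0|ab0] := eqVneq (a + b) 0.
  have /enorm_eq0/eqP : a = 0 by lra.
  by rewrite subr_eq0 => /eqP ->; exact: segmentL.
have ab : 0 < a + b by rewrite lt_neqAle eq_sym ab0 addr_ge0.
apply/segmentP; exists (a / (a + b)).
  by rewrite divr_ge0 ?(ltW ab) //= ler_pdivrMr // mul1r lerDl.
have e1 := congr1 fst e; have e2 := congr1 snd e; rewrite !planeE in e1 e2.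
apply: (scalerI ab0); rewrite (scaler_mix b a) //; last by rewrite addrC.
by apply: plane_eq; rewrite !planeE; lra.
Qed.

Lemma enormZ {R : realType} (a : R) (u : plane R) :
  0 <= a -> enorm (a *: u) = a * enorm u.
Proof.
move=> a0; rewrite /enorm !planeE -[a in RHS]ger0_norm // -sqrtr_sqr.
by rewrite -sqrtrM ?sqr_ge0 //; congr Num.sqrt; ring.
Qed.

Lemma edist_segment {R : realType} (x p q : plane R) :
  segment p q x -> edist p q = edist p x + edist x q.
Proof.
move=> /segmentP[t /andP[t0 t1] ->]; rewrite !edistE.
have -> : p - ((1 - t) *: p + t *: q) = t *: (p - q).
  by apply: plane_eq; rewrite !planeE; ring.
have -> : (1 - t) *: p + t *: q - q = (1 - t) *: (p - q).
  by apply: plane_eq; rewrite !planeE; ring.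
by rewrite !enormZ ?subr_ge0 // -mulrDl [t + _]addrC subrK mul1r.
Qed.

Lemma edist_translate {R : realType} (w p q : plane R) :
  edist (p + w) (q + w) = edist p q.
Proof. by rewrite !edistE opprD addrACA subrr addr0. Qed.

Lemma edistZ {R : realType} (a : R) (p q : plane R) :
  0 <= a -> edist (a *: p) (a *: q) = a * edist p q.
Proof. by move=> a0; rewrite !edistE -scalerBr enormZ. Qed.

Lemma norm_le_edist {R : realType} (p q : plane R) : `|p - q| <= edist p q.
Proof.
rewrite prod_normE ge_max !planeE /edist.
by rewrite -!sqrtr_sqr !ler_wsqrtr // ?lerDl ?lerDr sqr_ge0.
Qed.

(** * Length of polygonal paths *)

Lemma poly_length_ge0 {R : realType} (P : seq (plane R)) : 0 <= poly_length P.
Proof. by apply: sumr_ge0 => i _; exact: edist_ge0. Qed.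

Lemma poly_length1 {R : realType} (p : plane R) : poly_length [:: p] = 0.
Proof. by rewrite /poly_length big_ord0. Qed.

Lemma poly_length_cons2 {R : realType} (p q : plane R) (s : seq (plane R)) :
  poly_length [:: p, q & s] = edist p q + poly_length (q :: s).
Proof. by rewrite /poly_length /= big_ord_recl. Qed.

Lemma poly_length_cat {R : realType} (s1 s2 : seq (plane R)) :
  s1 != [::] -> s2 != [::] ->
  poly_length (s1 ++ s2) =
  poly_length s1 + edist (last 0 s1) (head 0 s2) + poly_length s2.
Proof.
move=> + s2n; elim: s1 => //= p [|q s1] IH _ /=.
  case: s2 s2n {IH} => //= q s2 _.
  by rewrite poly_length_cons2 poly_length1 add0r.
by rewrite !poly_length_cons2 IH //= !addrA.
Qed.

Lemma poly_length_rev {R : realType} (s : seq (plane R)) :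
  poly_length (rev s) = poly_length s.
Proof.
elim: s => //= p [|q s] IH //; rewrite rev_cons -cats1 poly_length_cat //.
  rewrite IH poly_length1 addr0 poly_length_cons2 /= rev_cons last_rcons.
  by rewrite addrC edistC.
by rewrite -size_eq0 size_rev.
Qed.

Lemma poly_length_delete {R : realType} (s1 s2 : seq (plane R)) (p : plane R) :
  poly_length (s1 ++ s2) <= poly_length (s1 ++ p :: s2).
Proof.
have le_cons q s : poly_length s <= poly_length (q :: s).
  case: s => [|r s]; last by rewrite poly_length_cons2 lerDr edist_ge0.
  by rewrite poly_length1 /poly_length big_ord0.
have [->|s1n] := eqVneq s1 [::]; first exact: le_cons.
rewrite (poly_length_cat s1 (p :: s2)) //.
case: s2 => [|q s2].
  by rewrite cats0 -addrA lerDl addr_ge0 ?poly_length_ge0 ?edist_ge0.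
rewrite poly_length_cat // poly_length_cons2 /=.
rewrite -!addrA lerD2l addrA lerD2r; exact: edist_triangle.
Qed.

Lemma poly_length_map {R : realType} (f : plane R -> plane R) (a : R)
    (P : seq (plane R)) :
  (forall p q, edist (f p) (f q) = a * edist p q) ->
  poly_length (map f P) = a * poly_length P.
Proof.
move=> fa; rewrite /poly_length size_map mulr_sumr; apply: eq_bigr => i _.
have iP : (i.+1 < size P)%N by rewrite -ltn_predRL.
by rewrite !(nth_map 0) // ltnW.
Qed.

(** * Rigid motions and hulls *)

(** [escapes X] is [avoids (interior (triangle R)) X]. *)
Definition avoids {R : realType} (K X : set (plane R)) : Prop :=
  forall (theta : R) (v : plane R), ~ (rigid_motion theta v @` X `<=` K).

Lemma rigid_motion_mix {R : realType} (theta : R) (v p q : plane R) (t : R) :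
  rigid_motion theta v ((1 - t) *: p + t *: q) =
  (1 - t) *: rigid_motion theta v p + t *: rigid_motion theta v q.
Proof. by apply: plane_eq; rewrite /rigid_motion !planeE /=; ring. Qed.

(** A rigid motion is affine, so it carries a set into a convex [K] as soon as
    it carries a set with a larger hull into [K]. *)
Lemma avoids_hull {R : realType} (K X Y : set (plane R)) :
  @convex_set R (plane R) K -> X `<=` hull Y -> avoids K X -> avoids K Y.
Proof.
move=> /convex_setP cK XY aX th v YK; apply: (aX th v) => _ [x /XY Yx <-].
suff : hull Y `<=` rigid_motion th v @^-1` K by apply.
apply: hull_min => [|y Yy]; last by apply: YK; exists y.
by apply/convex_setP => p q t Kp Kq t01; rewrite /= rigid_motion_mix; exact: cK.
Qed.

Lemma poly_trace_sub_hull {R : realType} (P : seq (plane R)) :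
  poly_trace P `<=` hull [set` P].
Proof.
move=> x [|[i /= iP]]; first exact: sub_hull.
have {}iP : (i.+1 < size P)%N by rewrite -ltn_predRL.
by apply: segment_sub; [exact: convex_hull| |]; apply: sub_hull;
  rewrite /= mem_nth // ltnW.
Qed.

Lemma hull_poly_trace {R : realType} (P : seq (plane R)) :
  hull (poly_trace P) = hull [set` P].
Proof.
apply/seteqP; split.
  by apply: hull_min; [exact: convex_hull|exact: poly_trace_sub_hull].
by apply: hullS => x Px; left.
Qed.

Lemma avoids_poly_trace {R : realType} (K : set (plane R)) (P : seq (plane R)) :
  @convex_set R (plane R) K -> avoids K (poly_trace P) <-> avoids K [set` P].
Proof.
move=> cK; split; apply: avoids_hull => //; first exact: poly_trace_sub_hull.
by move=> x Px; apply: sub_hull; left.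
Qed.

(** * Tight escape paths are standard *)

(** The diagonals of a convex quadrilateral are longer than two opposite sides:
    going from [a] to [c] and from [b] to [d] through the crossing point [x]
    costs as much as the diagonals, and if no shortcut were gained, [x] would
    lie on the segment from [a] to [c] as well, aligning [a], [b] and [c]. *)
Lemma edist_uncross {R : realType} (a b c d x : plane R) :
  segment a b x -> segment c d x ->
  ~ segment c d a -> ~ segment a c b -> ~ segment a b c ->
  edist a c + edist b d < edist a b + edist c d.
Proof.
move=> abx cdx nA nB nC; rewrite ltNge; apply/negP => le.
have := edist_segment x a b abx; have := edist_segment x c d cdx.
have := edist_triangle x b d; rewrite (edistC b x) => ? ? ?.
have acx : segment a c x by apply: edist_triangle_eq; rewrite (edistC x c); lra.
have xa : x <> a by move=> xa; apply: nA; rewrite -xa.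
by case: (segments_through a b c x xa abx acx).
Qed.

Lemma poly_length_reverse {R : realType} (A M D : seq (plane R)) :
  A != [::] -> M != [::] -> D != [::] ->
  poly_length (A ++ rev M ++ D) +
    (edist (last 0 A) (head 0 M) + edist (last 0 M) (head 0 D)) =
  poly_length (A ++ M ++ D) +
    (edist (last 0 A) (last 0 M) + edist (head 0 M) (head 0 D)).
Proof.
move=> A0 M0 D0; case/lastP: M M0 => // M y; rewrite -size_eq0 => _.
have last_rev (s : seq (plane R)) : last 0 (rev s) = head 0 s.
  by case: s => //= q s; rewrite rev_cons last_rcons.
have head_cat (s : seq (plane R)) : s != [::] -> head 0 (s ++ D) = head 0 s.
  by case: s.
have n1 : rcons M y != [::] by case: M.
have n2 : rev (rcons M y) != [::] by rewrite rev_rcons.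
have cat0 (s : seq (plane R)) : s != [::] -> s ++ D != [::] by case: s.
rewrite !poly_length_cat ?cat0 // !head_cat // last_rev poly_length_rev.
rewrite rev_rcons last_rcons /=; ring.
Qed.

(** The consequences of minimality that force a path to be standard. The strict
    inequality encodes that, among shortest paths, the number of vertices is
    least. By [avoids_poly_trace] escaping is a property of the set of
    vertices. *)
Definition tight_escape {R : realType} (K : set (plane R))
    (P : seq (plane R)) : Prop :=
  [/\ P != [::], avoids K [set` P],
      forall Q, Q != [::] -> size Q = size P -> avoids K [set` Q] ->
        poly_length P <= poly_length Q
    & forall Q, Q != [::] -> (size Q < size P)%N -> avoids K [set` Q] ->
        poly_length P < poly_length Q].

(** Otherwise [p] could be dropped: the hull stays the same, and the path does
    not get longer by the triangle inequality. *)
Lemma tight_notin_hull {R : realType} (K : set (plane R))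
    (s1 s2 : seq (plane R)) (p : plane R) :
  @convex_set R (plane R) K -> tight_escape K (s1 ++ p :: s2) ->
  ~ hull [set` s1 ++ s2] p.
Proof.
move=> cK [_ aP _ short] Hp.
have [e|nil] := eqVneq (s1 ++ s2) [::].
  suff : hull (R := R) [set` s1 ++ s2] `<=` set0 by move=> /(_ p Hp).
  by apply: hull_min; [apply/convex_setP|rewrite e].
have := short (s1 ++ s2) nil; rewrite !size_cat /= addnS ltnS leqnn => /(_ isT).
have : avoids K [set` s1 ++ s2].
  apply: avoids_hull cK _ aP => q /=; rewrite mem_cat inE.
  move=> /or3P[qs|/eqP ->//|qs].
    by apply: sub_hull; rewrite /= mem_cat qs.
  by apply: sub_hull; rewrite /= mem_cat qs orbT.
move=> a /(_ a); rewrite ltNge => /negP; apply; exact: poly_length_delete.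
Qed.

Lemma tight_uniq {R : realType} (K : set (plane R)) (P : seq (plane R)) :
  @convex_set R (plane R) K -> tight_escape K P -> uniq P.
Proof.
move=> cK tP; apply/negPn/negP => /(uniqPn 0)[i [j [ij jP e]]].
have iP := ltn_trans ij jP.
move: tP; rewrite -{1}(cat_take_drop i P) (drop_nth 0 iP).
move=> /(tight_notin_hull _ _ _ _ cK).
apply; apply: sub_hull; rewrite /= mem_cat e; apply/orP; right.
rewrite (_ : P`_j = (drop i.+1 P)`_(j - i.+1)).
  by rewrite mem_nth // size_drop ltn_sub2r // (leq_ltn_trans ij).
by rewrite nth_drop subnKC.
Qed.

Lemma tight_notin_hull_others {R : realType} (K : set (plane R))
    (P : seq (plane R)) (p : plane R) :
  @convex_set R (plane R) K -> tight_escape K P -> p \in P ->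
  ~ hull [set q | q \in P /\ q <> p] p.
Proof.
move=> cK + pP; case/splitPr: pP => s1 s2 /(tight_notin_hull _ _ _ _ cK) nH Hp.
apply: nH; apply: (hullS _ _ _ p Hp) => q [/=]; rewrite !mem_cat inE.
by case/or3P => [->//|/eqP //|->]; rewrite orbT.
Qed.

Lemma tight_notin_segment {R : realType} (K : set (plane R))
    (P : seq (plane R)) (p a b : plane R) :
  @convex_set R (plane R) K -> tight_escape K P ->
  p \in P -> a \in P -> b \in P -> a <> p -> b <> p -> ~ segment a b p.
Proof.
move=> cK tP pP aP bP ap bp abp.
apply: (tight_notin_hull_others K P p cK tP pP).
by move: abp; apply: segment_sub; [exact: convex_hull| |]; exact: sub_hull.
Qed.

Lemma tight_extreme {R : realType} (K : set (plane R)) (P : seq (plane R)) :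
  @convex_set R (plane R) K -> tight_escape K P ->
  [set` P] = extreme_points (hull (poly_trace P)).
Proof.
move=> cK tP; rewrite hull_poly_trace; apply/seteqP; split; last first.
  exact: extreme_points_hull_sub.
move=> p pP.
have := extreme_hull_setU1 p _ (tight_notin_hull_others K P p cK tP pP).
congr (extreme_points (hull _) p); apply/seteqP; split=> [q [->|[]]//|q qP].
by have [->|/eqP qp] := eqVneq q p; [left|right].
Qed.

(** Consecutive segments with a second common point would be aligned, putting
    one of three vertices between the other two. For crossing segments that are
    not consecutive, the path is changed by reversing its part from the end of
    the first segment to the start of the second. *)
Lemma tight_simple {R : realType} (K : set (plane R)) (P : seq (plane R)) :
  @convex_set R (plane R) K -> tight_escape K P -> poly_simple P.
Proof.
move=> cK tP i j /andP[ij]; rewrite ltn_predRL => jP.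
have uP := tight_uniq K P cK tP.
have inP k : (k <= j.+1)%N -> P`_k \in P.
  by move=> kj; rewrite mem_nth // (leq_ltn_trans kj).
have neP k l : (k < l <= j.+1)%N -> P`_k <> P`_l /\ P`_l <> P`_k.
  move=> /andP[kl lj]; have lP := leq_ltn_trans lj jP.
  have := nth_uniq 0 (ltn_trans kl lP) lP uP.
  rewrite (ltn_eqF kl) => /eqP ne.
  by split=> // /esym.
have nseg k l m : (k <= j.+1)%N -> (l <= j.+1)%N -> (m <= j.+1)%N ->
    P`_l <> P`_k -> P`_m <> P`_k -> ~ segment P`_l P`_m P`_k.
  by move=> ? ? ? ? ?; apply: (tight_notin_segment K P) => //; exact: inP.
case: ifPn => [/eqP je|ji].
  subst j; apply/seteqP; split=> [x [] |x ->]; last first.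
    by split; [exact: segmentR|exact: segmentL].
  rewrite segmentC => xi xj; apply: contrapT => /= xn.
  have [? ?] := neP i i.+1 ltac:(lia); have [? ?] := neP i i.+2 ltac:(lia).
  have [? ?] := neP i.+1 i.+2 ltac:(lia).
  by case: (segments_through _ _ _ _ xn xi xj); apply: nseg => //; lia.
have {}ij : (i.+1 < j)%N by rewrite ltn_neqAle eq_sym ji.
apply/seteqP; split=> // x [xi xj].
have [? ?] := neP i i.+1 ltac:(lia); have [? ?] := neP i j ltac:(lia).
have [? ?] := neP i j.+1 ltac:(lia); have [? ?] := neP i.+1 j ltac:(lia).
have lt : edist P`_i P`_j + edist P`_i.+1 P`_j.+1 <
          edist P`_i P`_i.+1 + edist P`_j P`_j.+1.
  by apply: (edist_uncross _ _ _ _ _ xi xj); apply: nseg => //; lia.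
have iP : (i.+1 < size P)%N by apply: ltn_trans jP; rewrite ltnW.
pose A := take i.+1 P; pose M := take (j - i) (drop i.+1 P).
pose D := drop j.+1 P.
have PE : P = A ++ M ++ D.
  rewrite /A /M /D (_ : drop j.+1 P = drop (j - i) (drop i.+1 P)).
    by rewrite !cat_take_drop.
  by rewrite drop_drop; congr drop; lia.
have sM : size M = (j - i)%N by rewrite /M size_takel // size_drop; lia.
have A0 : A != [::] by rewrite -size_eq0 size_takel // ltnW.
have M0 : M != [::].
  by rewrite -size_eq0 sM subn_eq0 -ltnNge (ltn_trans _ ij).
have D0 : D != [::] by rewrite -size_eq0 size_drop subn_eq0 -ltnNge.
have := poly_length_reverse A M D A0 M0 D0; rewrite -PE.
have -> : last 0 A = P`_i by rewrite /A (take_nth 0) ?last_rcons // ltnW.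
have -> : head 0 M = P`_i.+1.
  by rewrite -nth0 nth_take ?nth_drop ?addn0 // subn_gt0 ltnW.
have -> : last 0 M = P`_j.
  by rewrite -nth_last sM nth_take ?nth_drop; [congr nth; lia|lia].
have -> : head 0 D = P`_j.+1 by rewrite -nth0 nth_drop addn0.
have perm : perm_eq (A ++ rev M ++ D) P.
  by rewrite [X in perm_eq _ X]PE perm_cat2l perm_cat2r perm_rev.
have QP : [set` A ++ rev M ++ D] = [set` P].
  by apply/seteqP; split=> q /=; rewrite (perm_mem perm).
have Q0 : A ++ rev M ++ D != [::].
  by rewrite -size_eq0 (perm_size perm) -lt0n (ltn_trans _ iP).
case: tP => _ aP least _.
have := least _ Q0 (perm_size perm); rewrite QP => /(_ aP).
lra.
Qed.

Lemma tight_standard {R : realType} (K : set (plane R)) (P : seq (plane R)) :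
  @convex_set R (plane R) K -> tight_escape K P -> standard P.
Proof.
move=> cK tP; split; first exact: (tight_simple K).
  exact: (tight_uniq K).
exact: (tight_extreme K).
Qed.

(** * Existence of shortest polygonal escape paths *)

Lemma rigid_motion_continuous {R : realType} (theta : R) (v : plane R) :
  continuous (rigid_motion theta v).
Proof.
move=> p; apply: cvgD; last exact: cvg_cst.
have c1 : (fun q : plane R => q.1 : R) @ p --> p.1 by exact: cvg_fst.
have c2 : (fun q : plane R => q.2 : R) @ p --> p.2 by exact: cvg_snd.
have h1 : (fun q : plane R => cos theta * q.1 - sin theta * q.2 : R) @ p -->
    cos theta * p.1 - sin theta * p.2.
  by apply: cvgB; apply: cvgM => //; exact: cvg_cst.
have h2 : (fun q : plane R => sin theta * q.1 + cos theta * q.2 : R) @ p -->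
    sin theta * p.1 + cos theta * p.2.
  by apply: cvgD; apply: cvgM => //; exact: cvg_cst.
exact: (cvg_pair h1 h2).
Qed.

(** That a path fails to escape is an open condition on its vertices: some
    motion puts all of them in the open set [K]. *)
Lemma closed_avoids {R : realType} (K : set (plane R)) (n : nat) :
  open K ->
  closed [set f : prod_topology (fun _ : nat => plane R) |
    avoids K (f @` `I_n)].
Proof.
move=> oK; pose T := prod_topology (fun _ : nat => plane R).
rewrite (_ : mkset _ = \bigcap_(g in [set: R * plane R]) \bigcup_(i in `I_n)
    ((fun f : T => rigid_motion g.1 g.2 (f i)) @^-1` (~` K))).
  apply: closed_bigI => g _; apply: closed_bigcup; first exact: finite_II.
  move=> i _; apply: preimage_closed; last exact: open_closedC.
  move=> f _; apply: (@continuous_comp _ _ _ (fun f : T => f i)).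
    exact: proj_continuous.
  exact: rigid_motion_continuous.
apply/seteqP; split=> [f aK [th v] _ /= |f H th v fK].
  apply: contrapT => nH; apply: (aK th v) => _ [_ [i /= iN <-] <-].
  by apply: contrapT => nK; apply: nH; exists i.
have [i iN] := H (th, v) I; apply; apply: fK => /=.
by exists (f i) => //; exists i.
Qed.

Lemma edist_continuous {R : realType} (i j : nat) :
  continuous (fun f : prod_topology (fun _ : nat => plane R) =>
    edist (f i) (f j)).
Proof.
move=> f; pose T := prod_topology (fun _ : nat => plane R).
have c1 k : (fun g : T => (g k).1 : R) @ f --> (f k).1.
  apply: (@cvg_comp _ _ _ (fun g : T => g k) fst).
    exact: proj_continuous.
  exact: cvg_fst.
have c2 k : (fun g : T => (g k).2 : R) @ f --> (f k).2.
  apply: (@cvg_comp _ _ _ (fun g : T => g k) snd).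
    exact: proj_continuous.
  exact: cvg_snd.
have d1 := cvgB (c1 i) (c1 j); have d2 := cvgB (c2 i) (c2 j).
have d : (fun g : T =>
      ((g i).1 - (g j).1) ^+ 2 + ((g i).2 - (g j).2) ^+ 2) @ f -->
    ((f i).1 - (f j).1) ^+ 2 + ((f i).2 - (f j).2) ^+ 2.
  exact: (cvgD (cvgM (d1 _) (d1 _)) (cvgM (d2 _) (d2 _))).
exact: (cvg_comp _ _ d (@sqrt_continuous R _)).
Qed.

Lemma compact_box {R : realType} (L : R) :
  compact [set p : plane R | `|p| <= L].
Proof.
rewrite (_ : mkset _ = `[- L, L] `*` `[- L, L]).
  by apply: compact_setX; exact: segment_compact.
apply/seteqP; split=> p /=; rewrite prod_normE ge_max !ler_norml !in_itv /=.
  by case/andP.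
by case=> -> ->.
Qed.

Lemma avoids_translate {R : realType} (K X : set (plane R)) (w : plane R) :
  avoids K X -> avoids K [set p + w | p in X].
Proof.
move=> aX th v XK; apply: (aX th (v + (rigid_motion th 0 w))) => _ [p Xp <-].
rewrite (_ : rigid_motion _ _ _ = rigid_motion th v (p + w)).
  by apply: XK; exists (p + w) => //; exists p.
by apply: plane_eq; rewrite /rigid_motion !planeE /=; ring.
Qed.

(** The last vertex is repeated for ever, so that paths with different numbers
    of segments live in one space; the first vertex is moved to the origin, so
    that a bound on the length bounds the path. *)
Definition pad {R : realType} (Q : seq (plane R)) (i : nat) : plane R :=
  Q`_(minn i (size Q).-1) - Q`_0.

Lemma pad_length {R : realType} (Q : seq (plane R)) (n : nat) :
  (size Q <= n.+1)%N ->
  \sum_(i < n) edist (pad Q i) (pad Q i.+1) = poly_length Q.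
Proof.
move=> sQ; rewrite /poly_length.
have sn : ((size Q).-1 <= n)%N by rewrite -subn1 leq_subLR add1n.
rewrite (big_ord_widen _ (fun i => edist Q`_i Q`_i.+1) sn) [RHS]big_mkcond /=.
apply: eq_bigr => i _; rewrite /pad edist_translate.
case: ltnP => iQ; first by rewrite !(minn_idPl _) // ltnW.
by rewrite !(minn_idPr _) ?edistxx // (leq_trans iQ).
Qed.

Lemma pad_norm {R : realType} (Q : seq (plane R)) (i : nat) :
  `|pad Q i| <= poly_length Q.
Proof.
apply: le_trans (norm_le_edist _ _) _; rewrite edistC.
have : (minn i (size Q).-1 <= (size Q).-1)%N by rewrite geq_minr.
rewrite /poly_length; set k := minn _ _ => kQ.
apply: (@le_trans _ _ (\sum_(j < k) edist Q`_j Q`_j.+1)).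
  elim: k {kQ} => [|k IH]; first by rewrite edistxx big_ord0.
  rewrite big_ord_recr /= (le_trans (edist_triangle Q`_k _ _)) //.
  by rewrite lerD2r.
rewrite (big_ord_widen _ (fun i => edist Q`_i Q`_i.+1) kQ) big_mkcond /=.
by apply: ler_sum => j _; case: ifP => // _; exact: edist_ge0.
Qed.

Lemma pad_vertices {R : realType} (Q : seq (plane R)) (n : nat) :
  Q != [::] -> (size Q <= n.+1)%N ->
  pad Q @` `I_n.+1 = [set p - Q`_0 | p in [set` Q]].
Proof.
move=> Q0 sQ; have sQ0 : (0 < size Q)%N by rewrite lt0n size_eq0.
apply/seteqP; split=> x [].
  move=> i _ <-; exists Q`_(minn i (size Q).-1) => //=.
  by rewrite mem_nth // -[X in (_ < X)%N](prednK sQ0) ltnS geq_minr.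
move=> p /= pQ <-; exists (index p Q).
  by rewrite (leq_trans _ sQ) ?index_mem.
rewrite /pad (minn_idPl _) ?nth_index //.
by rewrite -ltnS prednK // index_mem.
Qed.

(** Only paths no longer than [P0] compete, and after padding they lie in a
    product of boxes, compact by Tychonoff's theorem. *)
Lemma exists_shortest {R : realType} (K : set (plane R)) (n : nat)
    (P0 : seq (plane R)) :
  open K -> P0 != [::] -> (size P0 <= n.+1)%N -> avoids K [set` P0] ->
  exists P, [/\ P != [::], (size P <= n.+1)%N, avoids K [set` P] &
    forall Q, Q != [::] -> (size Q <= n.+1)%N -> avoids K [set` Q] ->
      poly_length P <= poly_length Q].
Proof.
move=> oK P00 sP0 aP0; pose T := prod_topology (fun _ : nat => plane R).
pose len (f : T) := \sum_(i < n) edist (f i) (f i.+1).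
pose box := [set p : plane R | `|p| <= poly_length P0].
pose B := [set f : T | forall i, box (f i)].
pose E := [set f : T | avoids K (f @` `I_n.+1)] `&` B.
have padE Q : Q != [::] -> (size Q <= n.+1)%N -> avoids K [set` Q] ->
    poly_length Q <= poly_length P0 -> E (pad Q).
  move=> Q0 sQ aQ lQ; split => /=.
    by rewrite pad_vertices //; exact: avoids_translate.
  by move=> i; apply: le_trans lQ; exact: pad_norm.
have cE : compact E.
  apply: (@subclosed_compact _ _ B).
  - apply: closedI; first exact: closed_avoids.
    rewrite (_ : B = \bigcap_(i in setT) ((fun f : T => f i) @^-1` box)).
      apply: closed_bigI => i _; apply: preimage_closed.
        by move=> f _; exact: proj_continuous.
      by apply: compact_closed; [exact: norm_hausdorff|exact: compact_box].
    by apply/seteqP; split=> f H i; [move=> _|]; exact: H.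
  - apply: (@tychonoff nat (fun _ => plane R) (fun _ => box)) => _.
    exact: compact_box.
  - by move=> f [].
have clen : continuous len.
  rewrite /len; elim: (n) => [|m IH].
    rewrite (_ : (fun _ => _) = cst 0); first exact: cst_continuous.
    by apply/funext => f; rewrite big_ord0.
  rewrite (_ : (fun _ => _) = fun f : T =>
    \sum_(i < m) edist (f i) (f i.+1) + edist (f m) (f m.+1)).
    by move=> f; exact: cvgD (IH f) (@edist_continuous R m m.+1 f).
  by apply/funext => f; rewrite big_ord_recr.
have P0E := padE _ P00 sP0 aP0 (lexx _).
have E0 : E !=set0 by exists (pad P0).
have [f + fmin] := compact_EVT_min E0 cE (continuous_subspaceT clen).
rewrite inE => -[af _].
exists (mkseq f n.+1); split.
- by [].
- by rewrite size_mkseq.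
- suff -> : [set` mkseq f n.+1] = f @` `I_n.+1 by [].
  apply/seteqP; split=> p /=.
    by case/mapP => i; rewrite mem_iota => ? ->; exists i.
  by case=> i iN <-; apply/mapP; exists i => //; rewrite mem_iota.
move=> Q Q0 sQ aQ.
have -> : poly_length (mkseq f n.+1) = len f.
  rewrite /poly_length size_mkseq; apply: eq_bigr => i _.
  by rewrite !nth_mkseq ?ltnS ?(ltnW (ltn_ord i)) ?ltn_ord.
case: (leP (poly_length Q) (poly_length P0)) => lQ.
  by rewrite -(pad_length _ _ sQ); apply: fmin; rewrite inE; exact: padE.
apply: le_trans (ltW lQ); rewrite -(pad_length _ _ sP0).
by apply: fmin; rewrite inE.
Qed.

(** Among the shortest escape paths with at most [n] segments, one with the
    fewest vertices is tight: a path with fewer vertices is strictly longer. *)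
Lemma exists_tight {R : realType} (K : set (plane R)) (n : nat)
    (P0 : seq (plane R)) :
  open K -> P0 != [::] -> (size P0 <= n.+1)%N -> avoids K [set` P0] ->
  exists P, [/\ tight_escape K P, (size P <= n.+1)%N &
    forall Q, Q != [::] -> (size Q <= n.+1)%N -> avoids K [set` Q] ->
      poly_length P <= poly_length Q].
Proof.
move=> oK P00 sP0 aP0.
have [P1 [P10 sP1 aP1 minP1]] := exists_shortest K n P0 oK P00 sP0 aP0.
pose cand m := `[< exists P, [/\ size P = m, P != [::], avoids K [set` P] &
                             poly_length P <= poly_length P1] >].
have ex_cand : exists m, cand m by exists (size P1); apply/asboolP; exists P1.
have [m /asboolP[P [sP P_nil aP lP]] minm] := ex_minnP ex_cand.
have sPn : (size P <= n.+1)%N.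
  by rewrite sP (leq_trans _ sP1) // minm //; apply/asboolP; exists P1.
have minP Q : Q != [::] -> (size Q <= n.+1)%N -> avoids K [set` Q] ->
    poly_length P <= poly_length Q.
  by move=> Q0 sQ aQ; apply: le_trans lP (minP1 Q Q0 sQ aQ).
exists P; split=> //; split=> // Q Q0 sQ aQ; first by apply: minP; rewrite // sQ.
rewrite ltNge; apply/negP => lQ; move: sQ; rewrite ltnNge => /negP; apply.
by rewrite sP minm //; apply/asboolP; exists Q; split=> //; exact: le_trans lP.
Qed.

(** * From rectifiable to polygonal escape paths *)

(** The compact interval is covered by finitely many neighbourhoods on which
    [gamma] varies by less than [d]; their centres, with the end points, are
    the nodes. *)
Lemma fine_partition {R : realType} (gamma : R -> plane R) (d : R) :
  {within `[0, 1], continuous gamma} -> 0 < d ->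
  exists2 s, itv_partition 0 1 s &
    forall t : R, 0 <= t <= 1 ->
      exists2 u, u \in 0 :: s & `|gamma t - gamma u| < d.
Proof.
move=> /subspace_continuousP cg d0.
pose U t := [set x : R | 0 <= x <= 1 -> ball (gamma t) d (gamma x)].
have : @cover_compact R `[0, 1].
  by rewrite -compact_cover; exact: segment_compact.
move=> /(_ _ `[0, 1]%classic (fun t => interior (U t))).
case=> [t _|t t01|D D01 cD]; first exact: open_interior.
  exists t => //; rewrite /interior /=.
  have H : within `[0, 1]%classic (nbhs t) (gamma @^-1` ball (gamma t) d).
    exact: cg t t01 _ (nbhsx_ballx (gamma t) d d0).
  by apply: (@filterS R (nbhs t) _ _ (U t) _ H) => x; rewrite /U /= in_itv.
pose s0 := sort <=%O (undup [seq x <- D | 0 < x < 1]).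
have s0P x : (x \in s0) = (0 < x < 1) && (x \in D).
  by rewrite mem_sort mem_undup mem_filter.
exists (rcons s0 1); last first.
  move=> t t01; have [u /= uD] : cover [set` D] (fun t => interior (U t)) t.
    by apply: cD; rewrite /= in_itv.
  move=> /interior_subset /(_ t01); rewrite -ball_normE /= distrC => tu.
  exists u => //.
  have : 0 <= u <= 1 by have := D01 u uD; rewrite in_setE /= in_itv.
  move=> /andP[].
  rewrite !le_eqVlt inE mem_rcons inE s0P (eq_sym u 0).
  by move=> /orP[->//|->] /orP[->|->]; rewrite ?orbT // uD !orbT.
split; last by rewrite last_rcons.
rewrite rcons_path; apply/andP; split.
  rewrite (path_sortedE lt_trans) sort_lt_sorted undup_uniq andbT.
  by apply/allP => x; rewrite s0P => /andP[/andP[]].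
by have := mem_last 0 s0; rewrite inE s0P => /orP[/eqP->//|/andP[/andP[]]].
Qed.

(** The norm is the sup norm, which rotations do not preserve; hence the
    factor. *)
Lemma rigid_motion_norm {R : realType} (theta : R) (w : plane R) :
  `|rigid_motion theta 0 w| <= 2 * `|w|.
Proof.
have := cos_max theta; have := sin_max theta.
set c := cos _; set s := sin _ => s1 c1.
have w1 : `|w.1| <= `|w| by rewrite [X in _ <= X]prod_normE le_max lexx.
have w2 : `|w.2| <= `|w| by rewrite [X in _ <= X]prod_normE le_max lexx orbT.
have le1 (a x : R) : `|a| <= 1 -> `|x| <= `|w| -> `|a * x| <= `|w|.
  move=> a1 xw; rewrite normrM (le_trans _ xw) //.
  by rewrite -[X in _ <= X]mul1r ler_wpM2r.
rewrite prod_normE ge_max /rigid_motion /= !addr0 mulrDl !mul1r.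
rewrite (le_trans (ler_normB _ _)) ?lerD ?le1 //=.
by rewrite (le_trans (ler_normD _ _)) ?lerD ?le1.
Qed.

(** If a motion puts the scaled copy of [Y] in [K], then moving [X] by the same
    rotation puts every [x] at a convex combination of the image of [a *: y] in
    [K] and of a point of the ball around [o], whose distance to [o] is the
    rotated error [x - y] magnified by [a / (a - 1)]. *)
Lemma avoids_approx {R : realType} (K X Y : set (plane R)) (o : plane R)
    (r a : R) :
  @convex_set R (plane R) K -> 0 < r -> 1 < a -> ball o r `<=` K -> avoids K X ->
  (forall x, X x -> exists2 y, Y y & 2 * a * `|x - y| < (a - 1) * r) ->
  avoids K [set a *: y | y in Y].
Proof.
move=> /convex_setP cK r0 a1 orK aX XY th v YK.
have a0 : a != 0 by lra.
have a10 : a - 1 != 0 by lra.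
pose mu := (a - 1) / a.
apply: (aX th (a^-1 *: v + mu *: o)) => _ [x Xx <-].
have [y Yy xy] := XY x Xx.
set w := x - y in xy.
have -> : rigid_motion th (a^-1 *: v + mu *: o) x =
    (1 - mu) *: rigid_motion th v (a *: y) +
    mu *: (o + (a / (a - 1)) *: rigid_motion th 0 w).
  by apply: plane_eq; rewrite /w /mu /rigid_motion !planeE /=; field;
    rewrite a0 a10.
apply: cK.
- by apply: YK; exists (a *: y) => //; exists y.
- apply: orK; rewrite -ball_normE /= opprD addrA subrr add0r normrN normrZ.
  have w2 := rigid_motion_norm th w; rewrite ger0_norm ?divr_ge0 //; try lra.
  by rewrite mulrAC ltr_pdivrMr; nra.
- rewrite /mu divr_ge0 ?ler_pdivrMr; lra.
Qed.

Lemma set_mem_map {S T : eqType} (f : S -> T) (s : seq S) :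
  [set` map f s] = f @` [set` s].
Proof.
apply/seteqP; split=> y /=; first by case/mapP => x xs ->; exists x.
by case=> x xs <-; exact: map_f.
Qed.

Lemma exists_polygonal_escape {R : realType} (K : set (plane R))
    (gamma : R -> plane R) (C : R) :
  @convex_set R (plane R) K -> open K -> 0 < C ->
  {within `[0, 1], continuous gamma} -> avoids K (gamma @` `[0, 1]) ->
  (curve_length gamma < C%:E)%E ->
  exists P, [/\ P != [::], avoids K [set` P] & poly_length P < C].
Proof.
move=> cK oK C0 cg aK lC.
have [K0|K_nonempty] := eqVneq K set0.
  (* Nothing fits into the empty set, not even a single point. *)
  exists [:: 0]; split; rewrite ?poly_length1 // K0 => th v.
  move=> /(_ (rigid_motion th v 0)); apply.
  by exists 0 => //=; rewrite inE.
have /set0P[w Kw] := K_nonempty.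
have /nbhs_ballP[r /= r0 orK] : nbhs w K by exact: open_nbhs_nbhs.
have part_le s : itv_partition 0 1 s ->
    ((poly_length [seq gamma t | t <- 0 :: s])%:E <= curve_length gamma)%E.
  by move=> ps; apply: ereal_sup_ubound; exists s.
have part1 : itv_partition (0 : R) 1 [:: 1] by split; rewrite //= ltr01.
have := part_le _ part1; have := poly_length_ge0 [seq gamma t | t <- [:: 0; 1]].
case: (curve_length gamma) lC part_le => [L | |] //.
  rewrite lte_fin => LC part_le l0; rewrite lee_fin => lL.
have L0 : 0 <= L by exact: le_trans lL.
have LC0 : 0 < L + C by lra.
(* Any factor strictly between 1 and [C / L] would do; this one also makes sense
   when [L = 0]. *)
have [a a1 aL] : exists2 a : R, 1 < a & a * L < C.
  exists (2 * C / (L + C)); first by rewrite ltr_pdivlMr //; lra.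
  rewrite mulrAC ltr_pdivrMr //.
  have : 0 < C * (C - L) by rewrite mulr_gt0 // subr_gt0.
  lra.
pose d := (a - 1) * r / (2 * a).
have d0 : 0 < d by rewrite divr_gt0 ?mulr_gt0 //; lra.
have [s ps sd] := fine_partition gamma d cg d0.
exists [seq a *: p | p <- [seq gamma t | t <- 0 :: s]]; split=> //; last first.
  rewrite (poly_length_map _ a); last by move=> p q; rewrite edistZ //; lra.
  apply: le_lt_trans aL; rewrite ler_pM2l; last lra.
  by rewrite -lee_fin; exact: part_le.
rewrite set_mem_map.
apply: (avoids_approx K _ _ w r a cK r0 a1 orK aK) => _ [t + <-].
rewrite /= in_itv /= => t01; have [u us tu] := sd t t01.
exists (gamma u); first exact: (map_f gamma us).
by rewrite mulrC -ltr_pdivlMr; [exact: tu|lra].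
Qed.

Theorem proposition3p2 (R : realType) (C : R) (hC : 0 < C)
  (hpath : exists gamma : R -> plane R,
     [/\ rectifiable_path gamma, escapes (gamma @` `[0, 1])
       & (curve_length gamma < C%:E)%E]) :
  exists (N m : nat) (eta : m.+1.-tuple (plane R)),
    [/\ (m <= N)%N, standard eta, escapes (poly_trace eta),
        poly_length eta < C
      & forall (k : nat) (Q : k.+1.-tuple (plane R)),
          (k <= N)%N -> escapes (poly_trace Q) ->
          poly_length eta <= poly_length Q].
Proof.
have [gamma [[cg _] eg lg]] := hpath.
pose K := interior (triangle R).
have cK : @convex_set R (plane R) K by apply: convex_interior; exact: convex_hull.
have oK : open K by exact: open_interior.
have [P0 [P00 aP0 lP0]] := exists_polygonal_escape K gamma C cK oK hC cg eg lg.
have sP0 : (size P0 <= (size P0).-1.+1)%N by exact: leqSpred.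
have [P [tP sP minP]] := exists_tight K _ P0 oK P00 sP0 aP0.
have [P_nil aP _ _] := tP.
have sPE : size P == (size P).-1.+1 by rewrite prednK // lt0n size_eq0.
exists (size P0).-1, (size P).-1, (Tuple sPE); split => /=.
- by rewrite -ltnS (eqP sPE) in sP *.
- exact: tight_standard cK tP.
- by apply/(avoids_poly_trace K P cK).
- by apply: le_lt_trans (minP P0 P00 sP0 aP0) lP0.
move=> k Q kN /(avoids_poly_trace K Q cK) aQ.
by apply: minP => //; rewrite -?size_eq0 size_tuple.
Qed.
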